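(* Let $P$ be a finite poset. The following are equivalent: (a) $P$ is N-free; (b) the incomparability orthoset $(P,\perp)$ is Dacey; (c) $L(P,\perp)$ is an orthomodular lattice.
   Context: For $x,y$ in a poset, $x\prec y$ means $x<y$ and there is no $z$ with $x<z<y$. Elements $(a,b,c,d)$ of $P$ form an N if $a<c$, $b\prec c$, $b<d$, and all other distinct pairs among $a,b,c,d$ are incomparable; $P$ is N-free if no quadruple forms an N. The incomparability orthoset is $(P,\perp)$ with $x\perp y$ iff $x,y$ are incomparable. For $X\subseteq P$, $X^\perp=\{y\in P\mid y\perp x\text{ for all }x\in X\}$; $X$ is orthoclosed if $X=X^{\perp\perp}$. $L(P,\perp)$ is the complete ortholattice of orthoclosed subsets ordered by inclusion, with meet intersection, join $(X\cup Y)^{\perp\perp}$ and orthocomplement $X\mapsto X^\perp$. A basis of an orthoclosed set $X$ is a maximal pairwise orthogonal subset of $X$. The orthoset is Dacey if for every orthoclosed $X$ and every basis $B$ of $X$, $X=B^{\perp\perp}$. An orthomodular lattice is an ortholattice satisfying $x\le y\implies y=x\vee(y\wedge x^\perp)$. *)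

(* Defs.v *)
From HB Require Import structures.
From mathcomp Require Import all_boot all_order.

Set Implicit Arguments.
Unset Strict Implicit.
Unset Printing Implicit Defensive.

Import Order.Theory.
Local Open Scope order_scope.

Section NFree.
Context {d : Order.disp_t} {P : finPOrderType d}.
Implicit Types a b c e x y z : P.

Definition covered_by x y : Prop := x < y /\ ~ (exists z, x < z < y).

Definition forms_N a b c e : Prop :=
  [/\ a < c, covered_by b c & b < e] /\ [/\ a >< b, a >< e & c >< e].

End NFree.

Definition N_free (d : Order.disp_t) (P : finPOrderType d) : Prop :=
  forall a b c e : P, ~ forms_N a b c e.

Record orthoset := Orthoset {
  carrier :> finType;
  orth : rel carrier;
  orth_sym : symmetric orth;
  orth_irr : irreflexive orth }.

Section Orthoclosed.
Variable X : orthoset.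
Implicit Types A B : {set X}.

Definition perp A : {set X} := [set y | [forall x in A, orth y x]].

Definition orthoclosed A : bool := A == perp (perp A).

Definition pairwise_orth B : bool :=
  [forall x in B, forall y in B, (x != y) ==> orth x y].

Definition is_basis A B : Prop :=
  maxset (fun C : {set X} => (C \subset A) && pairwise_orth C) B.

Definition dacey : Prop :=
  forall A B, orthoclosed A -> is_basis A B -> A = perp (perp B).

Lemma in_perp A y : reflect {in A, forall x, orth y x} (y \in perp A).
Proof. by rewrite inE; apply: (iffP forall_inP). Qed.

Lemma perpS A B : A \subset B -> perp B \subset perp A.
Proof.
move=> /subsetP sAB; apply/subsetP=> y /in_perp yB.
by apply/in_perp => x /sAB /yB.
Qed.

Lemma sub_perp2 A : A \subset perp (perp A).
Proof.
apply/subsetP=> x xA; apply/in_perp => y /in_perp yA.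
by rewrite orth_sym yA.
Qed.

Lemma perp3 A : perp (perp (perp A)) = perp A.
Proof. by apply/eqP; rewrite eqEsubset sub_perp2 andbT perpS ?sub_perp2. Qed.

Lemma orthoclosed_perp A : orthoclosed (perp A).
Proof. by rewrite /orthoclosed perp3. Qed.

Lemma perpU A B : perp (A :|: B) = perp A :&: perp B.
Proof.
apply/setP=> y; rewrite in_setI; apply/in_perp/andP.
  by move=> yAB; split; apply/in_perp => x xA; apply: yAB; rewrite inE xA ?orbT.
by case=> /in_perp yA /in_perp yB x; rewrite inE => /orP[/yA|/yB].
Qed.

Lemma orthoclosedI A B :
  orthoclosed A -> orthoclosed B -> orthoclosed (A :&: B).
Proof.
by move=> /eqP-> /eqP->; rewrite -perpU orthoclosed_perp.
Qed.

Lemma perp0 : perp set0 = setT.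
Proof. by apply/setP=> y; rewrite in_setT; apply/in_perp => x; rewrite inE. Qed.

Lemma perpT : perp setT = set0.
Proof.
apply/setP=> y; rewrite in_set0; apply/negP=> /in_perp /(_ y (in_setT y)).
by rewrite orth_irr.
Qed.

Lemma orthoclosed0 : orthoclosed set0.
Proof. by rewrite -perpT orthoclosed_perp. Qed.

Lemma orthoclosedT : orthoclosed setT.
Proof. by rewrite -perp0 orthoclosed_perp. Qed.

End Orthoclosed.

Record ocset (X : orthoset) := OCSet {
  ocset_val :> {set X};
  ocset_valP : orthoclosed ocset_val }.

HB.instance Definition _ (X : orthoset) := [isSub for @ocset_val X].
HB.instance Definition _ (X : orthoset) := [Finite of ocset X by <:].

Fact ocset_display : Order.disp_t. Proof. exact: Order.Disp tt tt. Qed.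

Section OrthoclosedLattice.
Variable X : orthoset.
Implicit Types A B C : ocset X.

Definition oc_le A B : bool := (A : {set X}) \subset B.
Definition oc_meet A B : ocset X :=
  OCSet (orthoclosedI (ocset_valP A) (ocset_valP B)).
Definition oc_join A B : ocset X :=
  OCSet (orthoclosed_perp (perp ((A : {set X}) :|: B))).
Definition oc_bot : ocset X := OCSet (orthoclosed0 X).
Definition oc_top : ocset X := OCSet (orthoclosedT X).
Definition oc_compl A : ocset X := OCSet (orthoclosed_perp A).

Fact oc_le_refl : reflexive oc_le.
Proof. by move=> A; apply: subxx. Qed.

Fact oc_le_anti : antisymmetric oc_le.
Proof. by move=> A B; rewrite /oc_le -eqEsubset => /eqP/val_inj. Qed.

Fact oc_le_trans : transitive oc_le.
Proof. by move=> B A C; apply: subset_trans. Qed.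

HB.instance Definition _ :=
  Order.Le_isPOrder.Build ocset_display (ocset X)
    oc_le_refl oc_le_anti oc_le_trans.

Fact oc_lexI A B C : (A <= oc_meet B C) = (A <= B) && (A <= C).
Proof. exact: subsetI. Qed.

Fact oc_leUx A B C : (oc_join A B <= C) = (A <= C) && (B <= C).
Proof.
transitivity ((A : {set X}) :|: B \subset C); last exact: subUset.
apply/idP/idP; first exact/subset_trans/sub_perp2.
by move=> /perpS/perpS; rewrite -(eqP (ocset_valP C)).
Qed.

Fact oc_le0x A : oc_bot <= A. Proof. exact: sub0set. Qed.
Fact oc_lex1 A : A <= oc_top. Proof. exact: subsetT. Qed.

HB.instance Definition _ :=
  Order.POrder_isMeetSemilattice.Build ocset_display (ocset X) oc_lexI.
HB.instance Definition _ :=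
  Order.POrder_isJoinSemilattice.Build ocset_display (ocset X) oc_leUx.
HB.instance Definition _ :=
  Order.hasBottom.Build ocset_display (ocset X) oc_le0x.
HB.instance Definition _ :=
  Order.hasTop.Build ocset_display (ocset X) oc_lex1.

End OrthoclosedLattice.

Section Orthomodular.
Context {d : Order.disp_t} {L : tbLatticeType d}.
Variable compl : L -> L.

Definition ortholattice : Prop :=
  [/\ involutive compl,
      forall x y, x <= y -> compl y <= compl x,
      forall x, x `&` compl x = \bot
    & forall x, x `|` compl x = \top].

Definition orthomodular_lattice : Prop :=
  ortholattice /\ (forall x y, x <= y -> y = x `|` (y `&` compl x)).

End Orthomodular.

Section Incomparability.
Context {d : Order.disp_t} (P : finPOrderType d).

Definition incomparable : rel P := fun x y => x >< y.

Fact incomparable_sym : symmetric incomparable.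
Proof. by move=> x y; rewrite /incomparable comparable_sym. Qed.

Fact incomparable_irr : irreflexive incomparable.
Proof. by move=> x; rewrite /incomparable comparablexx. Qed.

Definition incomparability_orthoset : orthoset :=
  Orthoset incomparable_sym incomparable_irr.

End Incomparability.

(* Main.v *)
Require Import Defs.
From mathcomp Require Import all_boot all_order.

Set Implicit Arguments.
Unset Strict Implicit.
Unset Printing Implicit Defensive.

Import Order.Theory.
Local Open Scope order_scope.

(** If [P] is not Dacey, some basis [B] of an orthoclosed [A] admits comparable
    [y \in A] and [z \in perp B].  Everything strictly between [y] and [z] lies
    in [A] or in [perp B], so [y] and [z] may be taken to form a cover; an
    element of [B] comparable to [y] and an element of [perp A] comparable to
    [z] then complete an N.  In the other direction, given an N [(a, b, c, e)],
    every element of an antichain containing [a] and [e] is incomparable to [b]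
    or to [c], because [b] is covered by [c].  For a maximal such antichain,
    orthomodularity forces [b] and [c] to be orthogonal, a contradiction. *)

(** * Bases and orthomodularity in an arbitrary orthoset *)

Section Orthosets.
Variable X : orthoset.
Implicit Types (A B : {set X}) (x y : X).

Lemma sub_perpC A B : (A \subset perp B) = (B \subset perp A).
Proof.
by apply/idP/idP => /perpS; apply: subset_trans; apply: sub_perp2.
Qed.

Lemma setI_perp A : A :&: perp A = set0.
Proof.
apply/setP=> x; rewrite !inE; apply/negP=> /andP[xA /forall_inP/(_ x xA)].
by rewrite orth_irr.
Qed.

Lemma pairwise_orthP B :
  reflect {in B &, forall x y, x != y -> orth x y} (pairwise_orth B).
Proof.
apply: (iffP forall_inP) => [h x y xB yB | h x xB].
  by move/forall_inP: (h x xB) => /(_ y yB)/implyP.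
by apply/forall_inP=> y yB; apply/implyP; apply: h.
Qed.

Lemma pairwise_orthU A B :
  pairwise_orth A -> pairwise_orth B -> B \subset perp A ->
  pairwise_orth (A :|: B).
Proof.
move=> /pairwise_orthP hA /pairwise_orthP hB /subsetP sBA.
apply/pairwise_orthP=> x y; rewrite !inE => /orP[xA|xB] /orP[yA|yB].
- exact: hA.
- by move=> _; rewrite orth_sym; move/in_perp: (sBA _ yB); apply.
- by move=> _; move/in_perp: (sBA _ xB); apply.
- exact: hB.
Qed.

Lemma pairwise_orth1 x : pairwise_orth [set x].
Proof. by apply/pairwise_orthP=> y z /set1P-> /set1P->; rewrite eqxx. Qed.

Lemma pairwise_orth0 : pairwise_orth (set0 : {set X}).
Proof. by apply/pairwise_orthP=> x y; rewrite inE. Qed.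

(** An element of [A :&: perp B] could be added to [B], and irreflexivity keeps it out of [B]; so
    maximality amounts to there being none. *)
Lemma is_basisP A B :
  is_basis A B <-> [/\ B \subset A, pairwise_orth B & A :&: perp B = set0].
Proof.
split=> [/maxsetP[/andP[sBA oB] maxB]|[sBA oB AB0]].
  split=> //; apply/eqP; rewrite -subset0; apply/subsetP=> x /setIP[xA xB].
  suff BxE : B :|: [set x] = B.
    have xB' : x \in B by rewrite -BxE !inE eqxx orbT.
    by rewrite -(setI_perp B) inE xB' xB.
  apply: maxB; last exact: subsetUl.
  rewrite subUset sBA sub1set xA /=; apply: pairwise_orthU => //.
    exact: pairwise_orth1.
  by rewrite sub1set.
apply/maxsetP; split; first by rewrite sBA oB.
move=> C /andP[/subsetP sCA /pairwise_orthP oC] sBC.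
apply/eqP; rewrite eqEsubset sBC andbT; apply/subsetP=> x xC.
apply/negPn/negP=> xNB.
suff : x \in A :&: perp B by rewrite AB0 inE.
rewrite inE sCA //=; apply/in_perp=> y yB; apply: oC => //.
  exact: subsetP yB.
by apply: contraNneq xNB => ->.
Qed.

Lemma basis_extend A B :
  B \subset A -> pairwise_orth B -> exists2 C, is_basis A C & B \subset C.
Proof.
move=> sBA oB.
have [|C basC sBC] := @maxset_exists X
  (fun C => (C \subset A) && pairwise_orth C) B; first by rewrite sBA.
by exists C.
Qed.

Lemma ortholattice_orthoclosed : ortholattice (@oc_compl X).
Proof.
split=> [A|A B|A|A].
- by apply: val_inj; rewrite /= -(eqP (ocset_valP A)).
- exact: perpS.
- by apply: val_inj; rewrite /= setI_perp.
- by apply: val_inj; rewrite /= perpU setI_perp perp0.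
Qed.

(** For [A <= B], a basis [C] of [A] and a basis [D] of [B :&: perp A] together form a basis of [B],
    so the Dacey property places [B] below the join. *)
Lemma dacey_orthomodular : dacey X -> orthomodular_lattice (@oc_compl X).
Proof.
move=> dX; split; first exact: ortholattice_orthoclosed.
move=> A B leAB; apply: le_anti; rewrite leUx leAB leIl !andbT.
have [C basC _] := basis_extend (sub0set A) pairwise_orth0.
have [D basD _] := basis_extend (sub0set (B :&: perp A)) pairwise_orth0.
have AE := dX _ _ (ocset_valP A) basC.
have /is_basisP[sCA oC _] := basC; have /is_basisP[sDBA oD BAD0] := basD.
have [sDB sDA] : D \subset B /\ D \subset perp A.
  by apply/andP; rewrite -subsetI.
have basCD : is_basis B (C :|: D).
  apply/is_basisP; split.
  - by rewrite subUset sDB (subset_trans sCA leAB).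
  - by apply: pairwise_orthU => //; apply: subset_trans sDA (perpS sCA).
  (* Since [A = perp (perp C)], [perp C] is [perp A]. *)
  - by rewrite perpU -BAD0 AE perp3 setIA.
rewrite /Order.le /= /oc_le (dX _ _ (ocset_valP B) basCD).
by apply/perpS/perpS/setUSS.
Qed.

(** Split [E] into the part [E1] orthogonal to [x] and the rest [E2], which is orthogonal to [y]. As
    [perp E] is empty, orthomodularity for [perp (perp E1)] below [perp E2] makes them equal; so [y]
    lies in [perp (perp E1)] while [x] lies in [perp E1]. *)
Lemma orthomodular_maximal_orth E x y :
    orthomodular_lattice (@oc_compl X) -> is_basis setT E ->
  {in E, forall z, orth z x || orth z y} -> orth x y.
Proof.
move=> [_ om] /is_basisP[_ /pairwise_orthP oE /eqP].
rewrite setTI => /eqP E0 Exy.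
pose E1 := E :&: perp [set x]; pose E2 := E :\: perp [set x].
have E2E1 : E2 \subset perp E1.
  apply/subsetP=> z /setDP[zE zNx]; apply/in_perp=> t /setIP[tE tx].
  by apply: oE => //; apply: contraNneq zNx => ->.
have E12 : perp (perp E1) \subset perp E2 by rewrite -sub_perpC perp3.
have := om (OCSet (orthoclosed_perp (perp E1))) (OCSet (orthoclosed_perp E2)).
move=> /(_ E12) /(congr1 (@ocset_val X)) /=.
rewrite perp3 -perpU [E2 :|: E1]setUC setID E0 setU0 perp3 => E2E.
have xE1 : x \in perp E1.
  apply/in_perp=> t /setIP[_ /in_perp/(_ x (set11 x))].
  by rewrite orth_sym.
suff : y \in perp E2.
  by rewrite E2E orth_sym => /in_perp; apply.
apply/in_perp=> t /setDP[tE]; rewrite orth_sym.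
have /orP[tx|//] := Exy t tE.
by case/negP; apply/in_perp=> _ /set1P->.
Qed.

End Orthosets.

(** * Covers and N's in a finite poset *)

Section Posets.
Context {d : Order.disp_t} {P : finPOrderType d}.
Implicit Types x y z : P.

(** Any element strictly between replaces one endpoint, according to whether [Q] or [R] holds of it;
    the open interval loses that element and shrinks. *)
Lemma exists_cover (Q R : P -> Prop) x y :
    (forall u v w, Q u -> R w -> u < v < w -> Q v \/ R v) ->
    Q x -> R y -> x < y ->
  exists u v, [/\ Q u, R v & covered_by u v].
Proof.
move=> QR; have [n] := ubnP #|[set u | x < u < y]|.
elim: n x y => // n IHn x y /ltnSE ltn Qx Ry xy.
have [/existsP[u /andP[xu uy]]|noz] := boolP [exists z, x < z < y]; last first.
  by exists x, y; split=> //; split=> // -[z xzy]; case/existsP: noz; exists z.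
have [Qu|Ru] := QR x u y Qx Ry (introT andP (conj xu uy)).
  apply: (IHn u y) => //; apply: leq_trans ltn.
  apply/proper_card/properP; split; last by exists u; rewrite inE ?xu ?ltxx.
  by apply/subsetP=> v; rewrite !inE => /andP[/(lt_trans xu)->].
apply: (IHn x u) => //; apply: leq_trans ltn.
apply/proper_card/properP; split; last by exists u; rewrite inE ?xu ?ltxx ?andbF.
by apply/subsetP=> v; rewrite !inE => /andP[->]/lt_trans->.
Qed.

(** Otherwise [z < y <= x], against [x >< z]. *)
Lemma incomp_comparable_lt x y z :
  x >< z -> z < y -> x >=< y -> x < y.
Proof.
move=> xz zy /comparable_ltgtP[//|yx|xy].
  by case/negP: xz; rewrite ge_comparable // ltW // (lt_trans zy).
by case/negP: xz; rewrite xy ge_comparable // ltW.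
Qed.

Lemma incomp_comparable_gt x y z :
  x >< z -> y < z -> x >=< y -> y < x.
Proof.
move=> xz yz /comparable_ltgtP[xy|//|xy].
  by case/negP: xz; rewrite le_comparable // ltW // (lt_trans xy).
by case/negP: xz; rewrite xy le_comparable // ltW.
Qed.

Lemma N_free_dacey : N_free P -> dacey (incomparability_orthoset P).
Proof.
set X := incomparability_orthoset P => NfP A B Acl /is_basisP[sBA oB AB0].
have APP z : z \notin A -> exists2 w : P, w \in perp A & w >=< z.
  rewrite {1}(eqP Acl) inE => /forall_inPn[w wA]; rewrite negbK => zw.
  by exists w; rewrite // comparable_sym.
have NBP u : u \notin perp B -> exists2 b : P, b \in B & b >=< u.
  rewrite inE => /forall_inPn[b bB]; rewrite negbK => ub.
  by exists b; rewrite // comparable_sym.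
have perpBNA z : z \in perp B -> z \notin A.
  by move=> zB; apply/negP=> zA; have := in_set0 z; rewrite -AB0 inE zA zB.
have ABP y : y \in A -> exists2 b : P, b \in B & b >=< y.
  by move=> yA; apply: NBP; apply: contraL yA; apply: perpBNA.
have perpP (C : {set X}) (x y : P) : x \in C -> y \in perp C -> x >< y.
  by move=> xC /in_perp/(_ x xC); rewrite orth_sym.
have perpAB (w b : P) : w \in perp A -> b \in B -> b >< w.
  by move=> wA bB; apply: (perpP A) => //; apply: (subsetP sBA).
(* If [u] is in neither set, it is comparable to some [b] in [B] and some [w] in [perp A]. As
   [b >< z] and [w >< y], this forces [b < u < w], impossible for [b] in [A]. *)
have midl (z u y : P) : z \in perp B -> y \in A -> z < u < y ->
    u \in perp B \/ u \in A.
  move=> zB yA /andP[zu uy].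
  have [uA|/APP[w wA wu]] := boolP (u \in A); first by right.
  have [uB|/NBP[b bB bu]] := boolP (u \in perp B); first by left.
  have b_u := incomp_comparable_lt (perpP B b z bB zB) zu bu.
  have wy : w >< y by rewrite comparable_sym (perpP A).
  have u_w := incomp_comparable_gt wy uy wu.
  case/negP: (perpAB w b wA bB).
  by rewrite le_comparable // ltW // (lt_trans b_u).
have midr (y u z : P) : y \in A -> z \in perp B -> y < u < z ->
    u \in A \/ u \in perp B.
  move=> yA zB /andP[yu uz].
  have [uA|/APP[w wA wu]] := boolP (u \in A); first by left.
  have [uB|/NBP[b bB bu]] := boolP (u \in perp B); first by right.
  have u_b := incomp_comparable_gt (perpP B b z bB zB) uz bu.
  have wy : w >< y by rewrite comparable_sym (perpP A).
  have w_u := incomp_comparable_lt wy yu wu.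
  case/negP: (perpAB w b wA bB).
  by rewrite ge_comparable // ltW // (lt_trans w_u).
apply/eqP; rewrite eqEsubset andbC; apply/andP; split.
  by rewrite (eqP Acl); apply/perpS/perpS.
apply/subsetP=> y yA; apply/in_perp=> z zB.
apply/negP=> /comparable_ltgtP[yz|zy|yz]; last first.
- by have /negP[] := perpBNA z zB; rewrite -yz.
- have [|z' [y' [z'B y'A cov]]] :=
    @exists_cover (fun x => x \in perp B) (fun x => x \in A) z y _ zB yA zy.
    exact: midl.
  have [b bB by'] := ABP y' y'A; have [w wA wz'] := APP z' (perpBNA z' z'B).
  have [z'y' _] := cov.
  have bz' := perpP B b z' bB z'B.
  have y'w := perpP A y' w y'A wA.
  apply: (NfP b z' y' w); split; split=> //; last exact: perpAB.
    exact: incomp_comparable_lt bz' z'y' by'.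
  by apply: incomp_comparable_gt z'y' wz'; rewrite comparable_sym.
- have [|y' [z' [y'A z'B cov]]] :=
    @exists_cover (fun x => x \in A) (fun x => x \in perp B) y z _ yA zB yz.
    exact: midr.
  have [b bB by'] := ABP y' y'A; have [w wA wz'] := APP z' (perpBNA z' z'B).
  have [y'z' _] := cov.
  have bz' := perpP B b z' bB z'B.
  have y'w := perpP A y' w y'A wA.
  have wy' : w >< y' by rewrite comparable_sym.
  (* The cover now rises from [A] to [perp B], so [b] and [w] exchange their roles in the N. *)
  apply: (NfP w y' z' b); split; split=> //.
  - exact: incomp_comparable_lt wy' y'z' wz'.
  - exact: incomp_comparable_gt bz' y'z' by'.
  - by rewrite comparable_sym perpAB.
  - by rewrite comparable_sym.
Qed.

Lemma orthomodular_N_free :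
  orthomodular_lattice (@oc_compl (incomparability_orthoset P)) -> N_free P.
Proof.
set X := incomparability_orthoset P.
move=> om a b c e [[ac [bc nocov] be] [ab ae ce]].
have oae : pairwise_orth ([set a] :|: [set e] : {set X}).
  apply: pairwise_orthU; try exact: pairwise_orth1.
  by rewrite sub1set; apply/in_perp=> _ /set1P->; rewrite orth_sym.
have [E basE] := basis_extend (subsetT _) oae.
rewrite subUset !sub1set => /andP[aE eE].
have /is_basisP[_ /pairwise_orthP oE _] := basE.
have EE (x y : P) : x \in E -> y \in E -> x < y -> False.
  move=> xE yE xy; have /negP[] : x >< y by apply: oE; rewrite ?lt_eqF.
  by rewrite le_comparable // ltW.
suff : @orth X b c by move/negP; apply; rewrite le_comparable // ltW.
apply: (orthomodular_maximal_orth om basE) => x xE.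
apply/negPn/negP; rewrite negb_or /= !negbK => /andP[xb xc].
(* If [x <= b] then [x < e]; if [c <= x] then [a < x]; both contradict that [E] is an antichain.
   Only [b < x < c] remains, which the cover excludes. *)
case: (comparable_ltgtP xb) => [xltb|bltx|xeb].
- exact: EE xE eE (lt_trans xltb be).
- case: (comparable_ltgtP xc) => [xltc|cltx|xec].
  + by apply: nocov; exists x; rewrite bltx.
  + exact: EE aE xE (lt_trans ac cltx).
  + by apply: EE aE xE _; rewrite xec.
- by apply: EE xE eE _; rewrite xeb.
Qed.

End Posets.

Theorem theorem4p2 (d : Order.disp_t) (P : finPOrderType d) :
  [<-> N_free P;
       dacey (incomparability_orthoset P);
       orthomodular_lattice (@oc_compl (incomparability_orthoset P))].
Proof.
tfae.
- exact: N_free_dacey.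
- exact: dacey_orthomodular.
- exact: orthomodular_N_free.
Qed.
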